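(* Let $n$ be a positive integer with prime factorization $n=\prod_{p\mid n}p^{r(p)}$, let $k,l$ be positive integers, and let $A$, $b$, $w$ be given with entries in $\mathbb{Z}_n$, of sizes $k\times l$, $k\times 1$, $l\times 1$. Then there exists $x\in\mathbb{Z}_n^l$ with $Ax\equiv b\pmod n$ and $\langle w,x\rangle$ coprime to $n$ if and only if for each prime divisor $p$ of $n$ there exists $x(p)\in(\mathbb{Z}/(p^{r(p)}))^l$ with $Ax(p)\equiv b\pmod{p^{r(p)}}$ and $\langle w,x(p)\rangle\not\equiv 0\pmod p$. Moreover, if for each prime divisor $p$ of $n$ the vector $x(p)$ is such a solution, and $x$ is the vector in $\mathbb{Z}_n^l$ with $x\equiv x(p)\pmod{p^{r(p)}}$ for all primes $p\mid n$, then $Ax\equiv b\pmod n$ and $\langle w,x\rangle$ is coprime to $n$.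
   Context: $\langle u,v\rangle=\sum_i u_iv_i$. In the systems modulo $p^{r(p)}$, the data $A,b,w$ are reduced modulo $p^{r(p)}$. *)

(* Defs.v *)
From HB Require Import structures.
From mathcomp Require Import all_boot all_order all_algebra.

Set Implicit Arguments.
Unset Strict Implicit.
Unset Printing Implicit Defensive.

Import GRing.Theory.
Local Open Scope ring_scope.

(* The ring Z/mZ for every m > 0, carried by the representatives 0, ..., m - 1;
   Zmod 0 is junk.  The library's 'Z_m is not used because 'Z_1 is Z/2Z, whereas
   Zmod 1 is the zero ring, hence a comPzRingType. *)
Definition Zmod (m : nat) : Type := 'I_m.-1.+1.

HB.instance Definition _ (m : nat) := Finite.copy (Zmod m) 'I_m.-1.+1.
HB.instance Definition _ (m : nat) := GRing.Zmodule.copy (Zmod m) 'I_m.-1.+1.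
HB.instance Definition _ (m : nat) :=
  GRing.Zmodule_isComPzRing.Build (Zmod m)
    (@Zp_mulA m.-1.+1) (@Zp_mulC m.-1.+1) (@Zp_mul1z m.-1)
    (@Zp_mul_addl m.-1.+1).

Definition Zmod_val (m : nat) (a : Zmod m) : nat := nat_of_ord a.

(* Well defined on residue classes only when q divides m. *)
Definition reduce (m q : nat) (a : Zmod m) : Zmod q := inZp (Zmod_val a).

Definition reduce_mx (m q r c : nat) (M : 'M[Zmod m]_(r, c)) :
  'M[Zmod q]_(r, c) := map_mx (@reduce m q) M.

Definition inner (R : pzRingType) (l : nat) (u v : 'cV[R]_l) : R :=
  \sum_(i < l) u i 0 * v i 0.

Definition is_solution (n k l : nat) (A : 'M[Zmod n]_(k, l)) (b : 'cV[Zmod n]_k)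
    (w x : 'cV[Zmod n]_l) : Prop :=
  A *m x = b /\ coprime (Zmod_val (inner w x)) n.

Definition is_local_solution (n k l : nat) (A : 'M[Zmod n]_(k, l))
    (b : 'cV[Zmod n]_k) (w : 'cV[Zmod n]_l)
    (p : nat) (y : 'cV[Zmod (p ^ logn p n)]_l) : Prop :=
  reduce_mx (p ^ logn p n) A *m y = reduce_mx (p ^ logn p n) b /\
  ~~ (p %| Zmod_val (inner (reduce_mx (p ^ logn p n) w) y))%N.

Definition lifts (n l : nat) (x : 'cV[Zmod n]_l)
    (y : forall p : nat, 'cV[Zmod (p ^ logn p n)]_l) : Prop :=
  forall p : nat, prime p -> (p %| n)%N -> reduce_mx (p ^ logn p n) x = y p.

(* Main.v *)
Require Import Defs.
From mathcomp Require Import all_boot all_order all_algebra.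

(** The reduction maps [Z/n -> Z/p^r(p)] are ring morphisms, jointly injective
    and, by the Chinese remainder theorem, jointly surjective.  A residue is
    coprime to [n] exactly when no prime [p | n] divides it, which can be read
    off modulo [p^r(p)] since [p | p^r(p)]. *)

(** Induction on [s]: the two-modulus [chinese] glues the value wanted at the head to the one built
    for the tail, the second modulus being the product over the tail. *)
Lemma chinese_seq (s : seq nat) (m c : nat -> nat) :
  uniq s -> {in s &, forall p q, p != q -> coprime (m p) (m q)} ->
  exists N, {in s, forall p, N = c p %[mod m p]}.
Proof.
elim: s => [|p s IHs] /=; first by exists 0.
case/andP=> ps us co.
have [|N HN] := IHs us.
  by move=> q r qs rs; apply: co; rewrite inE ?qs ?rs orbT.
have cop : coprime (m p) (\prod_(q <- s) m q).
  rewrite big_seq; elim/big_ind: _ => [|a d ca cd|q qs].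
  - exact: coprimen1.
  - by rewrite coprimeMr ca.
  - apply: co; rewrite ?inE ?eqxx ?qs ?orbT //.
    by apply: contraNneq ps => ->.
exists (chinese (m p) (\prod_(q <- s) m q) (c p) N) => q.
rewrite inE => /orP[/eqP->|qs]; first exact: chinese_modl.
(* Agreement modulo the product descends to its factor [m q]. *)
have dq : m q %| \prod_(r <- s) m r by rewrite (big_rem q) //= dvdn_mulr.
by rewrite -(HN q qs) -(modn_dvdm _ dq) chinese_modr // modn_dvdm.
Qed.

(** Positivity identifies the bound [q.-1.+1] with [q]; at [q = 0] the left side would be 0, while
    [%% 0] is the identity. *)
Lemma Zmod_val_reduce m q (a : Zmod m) :
  0 < q -> Zmod_val (reduce q a) = Zmod_val a %% q.
Proof. by case: q. Qed.

Lemma Zmod_val_lt m (a : Zmod m) : 0 < m -> Zmod_val a < m.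
Proof. by case: m a => // m a _; apply: ltn_ord. Qed.

Lemma Zmod_valD m (a c : Zmod m) :
  0 < m -> Zmod_val (a + c)%R = (Zmod_val a + Zmod_val c) %% m.
Proof. by case: m a c. Qed.

Lemma Zmod_valM m (a c : Zmod m) :
  0 < m -> Zmod_val (a * c)%R = (Zmod_val a * Zmod_val c) %% m.
Proof. by case: m a c. Qed.

Lemma Zmod_val_inj m : injective (@Zmod_val m).
Proof. exact: val_inj. Qed.

Section Reduce.
Variables (m q : nat).
Hypotheses (m_gt0 : 0 < m) (q_dvd_m : q %| m).

Let q_gt0 : 0 < q. Proof. exact: dvdn_gt0 q_dvd_m. Qed.

Lemma reduce0 : reduce q (0 : Zmod m)%R = 0%R.
Proof. by apply: Zmod_val_inj; rewrite Zmod_val_reduce // mod0n. Qed.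

(** Since [q] divides [m], the wrap-around modulo [m] is invisible modulo [q]. *)
Lemma reduceD : {morph @reduce m q : a c / (a + c)%R}.
Proof.
move=> a c; apply: Zmod_val_inj.
by rewrite Zmod_valD // !Zmod_val_reduce // Zmod_valD // modnDm modn_dvdm.
Qed.

Lemma reduceM : {morph @reduce m q : a c / (a * c)%R}.
Proof.
move=> a c; apply: Zmod_val_inj.
by rewrite Zmod_valM // !Zmod_val_reduce // Zmod_valM // modnMm modn_dvdm.
Qed.

Lemma reduce_mxM r s t (M : 'M[Zmod m]_(r, s)) (N : 'M[Zmod m]_(s, t)) :
  reduce_mx q (M *m N)%R = (reduce_mx q M *m reduce_mx q N)%R.
Proof.
apply/matrixP => i j; rewrite !mxE (big_morph _ reduceD reduce0).
by apply: eq_bigr => e _; rewrite reduceM !mxE.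
Qed.

Lemma reduce_inner l (u v : 'cV[Zmod m]_l) :
  inner (reduce_mx q u) (reduce_mx q v) = reduce q (inner u v).
Proof.
rewrite /inner (big_morph _ reduceD reduce0).
by apply: eq_bigr => e _; rewrite reduceM !mxE.
Qed.

End Reduce.

Lemma pfactor_logn_dvd p n : p ^ logn p n %| n.
Proof. by rewrite -p_part dvdn_part. Qed.

Lemma dvdn_pfactor_logn p n : 0 < n -> prime p -> p %| n -> p %| p ^ logn p n.
Proof. by move=> n0 pp pn; rewrite dvdn_exp // logn_gt0 mem_primes pp n0. Qed.

(** A gcd other than 1 exceeds 1, as [n] is positive, and then its least prime divisor divides both
    numbers. *)
Lemma coprime_primes m n :
  0 < n -> (forall p, prime p -> p %| n -> ~~ (p %| m)) <-> coprime m n.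
Proof.
move=> n0; split=> [H|co p pp pn].
  apply: contraT => g1; have g0 : 0 < gcdn m n by rewrite gcdn_gt0 n0 orbT.
  have /pdiv_prime pp : 1 < gcdn m n by rewrite ltn_neqAle eq_sym g1.
  have := pdiv_dvd (gcdn m n); rewrite dvdn_gcd => /andP[pm pn].
  by rewrite (negPf (H _ pp pn)) in pm.
apply/negP => pm; have : p %| gcdn m n by rewrite dvdn_gcd pm.
by rewrite (eqP co) dvdn1 => /eqP p1; rewrite p1 in pp.
Qed.

Lemma reduce_inj n (a c : Zmod n) : 0 < n ->
  (forall p, prime p -> p %| n ->
     reduce (p ^ logn p n) a = reduce (p ^ logn p n) c) -> a = c.
Proof.
move=> n0 H; apply: Zmod_val_inj.
rewrite -(modn_small (Zmod_val_lt _ a n0)) -(modn_small (Zmod_val_lt _ c n0)).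
(* Subtraction on [nat] truncates, so the two representatives are ordered before their difference is
   taken. *)
wlog le_ca : a c H / Zmod_val c <= Zmod_val a => [th|].
  case/orP: (leq_total (Zmod_val c) (Zmod_val a)) => le; first exact: th.
  by apply/esym/th => // p pp pn; rewrite H.
(* The difference is divisible by [n] as soon as every prime-power part of [n] divides it. *)
apply/eqP; rewrite eqn_mod_dvd //; apply/dvdn_partP => // p.
rewrite mem_primes => /and3P[pp _ pn]; rewrite p_part -eqn_mod_dvd //.
have q0 : 0 < p ^ logn p n by rewrite expn_gt0 prime_gt0.
by rewrite -!Zmod_val_reduce // H.
Qed.

Lemma reduce_mx_inj n r s (M N : 'M[Zmod n]_(r, s)) : 0 < n ->
  (forall p, prime p -> p %| n ->
     reduce_mx (p ^ logn p n) M = reduce_mx (p ^ logn p n) N) -> M = N.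
Proof.
move=> n0 H; apply/matrixP => i j; apply: reduce_inj => // p pp pn.
by have /matrixP/(_ i j) := H p pp pn; rewrite !mxE.
Qed.

Lemma reduce_surj n (c : forall p, Zmod (p ^ logn p n)) : 0 < n ->
  exists a : Zmod n,
    forall p, prime p -> p %| n -> reduce (p ^ logn p n) a = c p.
Proof.
move=> n0.
have [|N HN] := chinese_seq (primes n) (fun p => p ^ logn p n)
                  (fun p => Zmod_val (c p)) (primes_uniq n).
  move=> p q; rewrite !mem_primes => /andP[pp _] /andP[pq _] npq.
  by rewrite coprimeXl // coprimeXr // prime_coprime // dvdn_prime2.
exists (inZp N) => p pp pn; apply: Zmod_val_inj.
have q0 : 0 < p ^ logn p n by rewrite expn_gt0 prime_gt0.
(* The representative of [inZp N] is [N %% n]; reducing it further modulo a divisor of [n] gives the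
   residue of [N] itself. *)
rewrite Zmod_val_reduce // /Zmod_val /= prednK //.
rewrite (modn_dvdm _ (pfactor_logn_dvd p n)) HN ?mem_primes ?pp ?n0 //.
by rewrite modn_small // Zmod_val_lt.
Qed.

Lemma lifts_exists_unique n l (y : forall p, 'cV[Zmod (p ^ logn p n)]_l) :
  0 < n -> exists! x : 'cV[Zmod n]_l, lifts x y.
Proof.
(* Each coordinate is lifted separately; the index type being finite, [fin_all_exists] collects the
   lifts into a function without a choice axiom. *)
move=> n0; have [f Hf] := fin_all_exists
  (fun i => reduce_surj n (fun p => y p i ord0) n0).
exists (\col_i f i)%R; split=> [p pp pn|x xy].
  by apply/matrixP => i j; rewrite !mxE Hf // (ord1 j).
apply: reduce_mx_inj => // p pp pn; rewrite xy //.
by apply/matrixP => i j; rewrite !mxE Hf // (ord1 j).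
Qed.

(** The local-global principle for a fixed [x]: joint injectivity handles the equation, and
    coprimality is tested one prime at a time. *)
Lemma is_solution_reduce n k l (A : 'M[Zmod n]_(k, l)) (b : 'cV[Zmod n]_k)
    (w x : 'cV[Zmod n]_l) : 0 < n ->
  is_solution A b w x <->
  (forall p, prime p -> p %| n ->
     is_local_solution A b w (reduce_mx (p ^ logn p n) x)).
Proof.
move=> n0.
(* Reduction modulo [p ^ logn p n] preserves divisibility by [p], because the exponent is
   positive. *)
have inner_dvd p : prime p -> p %| n ->
    p %| Zmod_val (inner (reduce_mx (p ^ logn p n) w)
                         (reduce_mx (p ^ logn p n) x))
    = (p %| Zmod_val (inner w x)).
  move=> pp pn; rewrite reduce_inner ?pfactor_logn_dvd // Zmod_val_reduce.
    by rewrite /dvdn modn_dvdm // dvdn_pfactor_logn.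
  by rewrite expn_gt0 prime_gt0.
split=> [[Ax co] p pp pn|H].
  split; first by rewrite -reduce_mxM ?pfactor_logn_dvd // Ax.
  by rewrite inner_dvd //; apply: (coprime_primes _ _ n0).2 co _ pp pn.
split.
  apply: reduce_mx_inj => // p pp pn.
  by rewrite reduce_mxM ?pfactor_logn_dvd //; case: (H p pp pn).
apply/(coprime_primes _ _ n0) => p pp pn.
by rewrite -inner_dvd //; case: (H p pp pn).
Qed.

Theorem theorem4 (n k l : nat) (n_gt0 : 0 < n) (k_gt0 : 0 < k) (l_gt0 : 0 < l)
    (A : 'M[Zmod n]_(k, l)) (b : 'cV[Zmod n]_k) (w : 'cV[Zmod n]_l) :
  ((exists x : 'cV[Zmod n]_l, is_solution A b w x) <->
   (forall p : nat, prime p -> p %| n ->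
      exists y : 'cV[Zmod (p ^ logn p n)]_l, is_local_solution A b w y)) /\
  (forall y : forall p : nat, 'cV[Zmod (p ^ logn p n)]_l,
     (forall p : nat, prime p -> p %| n -> is_local_solution A b w (y p)) ->
     (exists! x : 'cV[Zmod n]_l, lifts x y) /\
     (forall x : 'cV[Zmod n]_l, lifts x y -> is_solution A b w x)).
Proof.
have glue (y : forall p, 'cV[Zmod (p ^ logn p n)]_l) :
    (forall p, prime p -> p %| n -> is_local_solution A b w (y p)) ->
    forall x : 'cV[Zmod n]_l, lifts x y -> is_solution A b w x.
  move=> Hy x xy; apply/is_solution_reduce => // p pp pn.
  by rewrite xy //; apply: Hy.
split; last by move=> y Hy; split; [exact: lifts_exists_unique | exact: glue].
split=> [[x /is_solution_reduce Hx] p pp pn|H].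
  by exists (reduce_mx (p ^ logn p n) x); apply: Hx.
(* A boolean form of [is_local_solution]: vectors over [Zmod] form a finite type, so [pick] can
   select one solution for each [p]. *)
pose loc p (y : 'cV[Zmod (p ^ logn p n)]_l) :=
  (reduce_mx (p ^ logn p n) A *m y == reduce_mx (p ^ logn p n) b)%R
  && ~~ (p %| Zmod_val (inner (reduce_mx (p ^ logn p n) w) y)).
(* The zero default only makes [y] total; at a prime divisor of [n], [H] ensures that [pick]
   succeeds. *)
pose y p := odflt (const_mx 0%R) [pick y | loc p y].
have Hy p : prime p -> p %| n -> is_local_solution A b w (y p).
  move=> pp pn; rewrite /y; case: pickP => [z /andP[/eqP]|no] //=.
  by have [z [Az wz]] := H p pp pn; have := no z; rewrite /loc Az eqxx wz.
have [x [xy _]] := lifts_exists_unique n l y n_gt0.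
by exists x; apply: glue xy.
Qed.
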